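(* Let $S$ be a numerical semigroup of depth $2$. If $\lambda(S)$ has a Durfee square of size at most $3$, then $S$ is $\lambda$-minimal.
   Context: $\mathbb{N}=\{0,1,2,\dots\}$. A numerical set is a subset $T\subseteq\mathbb{N}$ with $0\in T$ and finite complement in $\mathbb{N}$. Its gaps are the elements of $\mathrm{G}(T)=\mathbb{N}\setminus T$; the largest gap is the Frobenius number $\mathrm{F}(T)$; the smallest nonzero element of $T$ is its multiplicity $\mathrm{m}(T)$; the depth of $T$ is the unique nonnegative integer $\mathrm{q}(T)$ with $(\mathrm{q}(T)-1)\,\mathrm{m}(T)\le \mathrm{F}(T)<\mathrm{q}(T)\,\mathrm{m}(T)$. A numerical semigroup is a numerical set closed under addition. The enumeration $\lambda(T)$ of a numerical set $T$ is the integer partition whose Young diagram has as its profile (lower-right boundary) the lattice walk that, for $n=0,1,2,\dots,\mathrm{F}(T)$, takes a unit step right if $n\in T$ and a unit step up if $n\notin T$. Equivalently, the parts of $\lambda(T)$ are the numbers $\#\{u\in T: u<x\}$, one for each gap $x\in\mathrm{G}(T)$. The size $|\lambda|$ of a partition is the sum of its parts. A partition $\lambda$ has a Durfee square of size $k$ if $k$ is the largest positive integer $i$ such that $\lambda$ has at least $i$ parts of size at least $i$. The hook length of a box in the Young diagram of a partition $\lambda$ is the number of boxes to its right in the same row plus the number of boxes below it in the same column plus $1$; $\mathrm{H}(\lambda)$ is the set of all hook lengths of $\lambda$. For a numerical semigroup $S$, $\mathcal{P}(S)=\{\lambda:\mathrm{H}(\lambda)=\mathbb{N}\setminus S\}$;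 it is known that $\lambda(S)\in\mathcal{P}(S)$. $S$ is $\lambda$-minimal if $|\lambda(S)|\le|\lambda|$ for all $\lambda\in\mathcal{P}(S)$. *)

(* Defs.v *)
From mathcomp Require Import all_boot all_order all_algebra.
From mathcomp Require Import finmap zify.
From mathcomp Require Import boolp classical_sets functions cardinality.

Set Implicit Arguments.
Unset Strict Implicit.
Unset Printing Implicit Defensive.

Import Order.TTheory GRing.Theory Num.Theory.

Local Open Scope classical_set_scope.
Local Open Scope nat_scope.

Definition gaps (T : set nat) : set nat := ~` T.

Definition numerical_set (T : set nat) : Prop := T 0 /\ finite_set (gaps T).

Definition numerical_semigroup (S : set nat) : Prop :=
  numerical_set S /\ forall x y : nat, S x -> S y -> S (x + y).

(* The largest gap; by the usual convention it is -1 when there are no gaps,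
   that is, when T is the set of all natural numbers. *)
Definition frobenius (T : set nat) : int :=
  ((\max_(x <- fset_set (gaps T)) x.+1)%:Z - 1)%R.

Definition is_multiplicity (T : set nat) (m : nat) : Prop :=
  [/\ T m, 0 < m & forall x, T x -> 0 < x -> m <= x].

Definition multiplicity (T : set nat) : nat :=
  get [set m | is_multiplicity T m].

Definition is_depth (T : set nat) (q : nat) : Prop :=
  ((q%:Z - 1) * (multiplicity T)%:Z <= frobenius T
     < q%:Z * (multiplicity T)%:Z)%R.

Definition depth (T : set nat) : nat := get [set q | is_depth T q].

(* A partition is the list of its parts, in weakly decreasing order. *)
Definition is_partition (l : seq nat) : bool :=
  sorted geq l && all (leq 1) l.

(* Rows of the Young diagram lying to the left of a lattice walk
   (true = right, false = up) that starts in column c. Diagrams are drawn with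
   the largest part on top, so the walk, going up, meets the smallest parts
   first: the row closed by an up step has as its length the current column,
   and it is placed after all the rows closed later. *)
Fixpoint profile_rows (c : nat) (w : seq bool) : seq nat :=
  match w with
  | [::] => [::]
  | true :: w' => profile_rows c.+1 w'
  | false :: w' => rcons (profile_rows c w') c
  end.

(* The steps n = 0, 1, ..., F(T). *)
Definition profile (T : set nat) : seq bool :=
  [seq `[< T n >] | n <- iota 0 (absz (frobenius T + 1)%R)].

Definition enumeration (T : set nat) : seq nat := profile_rows 0 (profile T).

(* Rows and columns are numbered from 0, rows from top to bottom. *)
Definition in_diagram (l : seq nat) (i j : nat) : bool := j < nth 0 l i.

Definition arm (l : seq nat) (i j : nat) : nat := nth 0 l i - j.+1.

Definition leg (l : seq nat) (i j : nat) : nat :=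
  count (fun r => j < r) (drop i.+1 l).

Definition hook_length (l : seq nat) (i j : nat) : nat :=
  arm l i j + leg l i j + 1.

Definition hooks (l : seq nat) : set nat :=
  [set h | exists i j, in_diagram l i j /\ h = hook_length l i j].

Definition partitions_of (S : set nat) : set (seq nat) :=
  [set l | is_partition l /\ hooks l = gaps S].

Definition lambda_minimal (S : set nat) : Prop :=
  forall l, partitions_of S l -> sumn (enumeration S) <= sumn l.

Definition durfee_square (l : seq nat) (k : nat) : Prop :=
  [/\ 0 < k, k <= count (leq k) l &
      forall i, 0 < i -> i <= count (leq i) l -> i <= k].

(* The definitions by choice above are well posed. *)

Lemma frobenius_lt (T : set nat) (n : nat) : numerical_set T ->
  (frobenius T < n%:Z)%R <-> forall x, n <= x -> T x.
Proof.
move=> [_ fT]; rewrite /frobenius ltrBlDr -PoszD ltz_nat addn1 ltnS.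
split=> [h x nx|h].
  apply: contrapT => nTx.
  have : x \in fset_set (gaps T) by rewrite in_fset_set// inE.
  move=> xg; have := @leq_bigmax_seq _ _ xpredT succn _ xg isT.
  by move=> /leq_trans /(_ h); rewrite ltnNge nx.
apply/bigmax_leqP_seq => x; rewrite in_fset_set// inE => nTx _.
by rewrite ltnNge; apply/negP => /h.
Qed.

Lemma multiplicityP (T : set nat) :
  numerical_set T -> is_multiplicity T (multiplicity T).
Proof.
move=> nT; have [_ fT] := nT.
suff [m hm] : [set m | is_multiplicity T m] !=set0 by exact: (getI hm).
have ex : exists n, `[< T n >] && (0 < n).
  exists (\max_(x <- fset_set (gaps T)) x.+1).+1; rewrite andbT.
  apply/asboolP; apply: (iffLR (@frobenius_lt T _ nT) _ _ (leqnn _)).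
  by rewrite /frobenius ltrBlDr -PoszD ltz_nat addn1 ltnW.
case: (ex_minnP ex) => m /andP[/asboolP Tm m0] mmin.
by exists m; split=> // x Tx x0; apply: mmin; rewrite x0 andbT; apply/asboolP.
Qed.

Lemma depthP (T : set nat) (q : nat) :
  numerical_set T -> depth T = q <-> is_depth T q.
Proof.
move=> nT; have [_ m0 _] := multiplicityP nT.
have dE r : is_depth T r <-> r = (\max_(x <- fset_set (gaps T)) x.+1
    + (multiplicity T).-1) %/ multiplicity T.
  rewrite /is_depth /frobenius; set c := \max_(x <- _) _.
  move: (multiplicity T) m0 => m m0.
  have -> : ((r%:Z - 1) * m%:Z <= c%:Z - 1 < r%:Z * m%:Z)%R
      = (r * m <= c + m.-1 < r.+1 * m).
    by rewrite mulrBl mul1r -PoszM mulSn; lia.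
  split=> [/andP[h1 h2]|->]; last by rewrite leq_divM ltn_ceil.
  by apply/eqP; rewrite eqn_leq leq_divRL// h1 -ltnS ltn_divLR// h2.
have ex : [set r | is_depth T r] !=set0 by eexists; apply/dE.
by case: ex => r /getI; rewrite /= -/(depth T) => /dE e; rewrite dE e; split=> ->.
Qed.

Lemma profile_rowsE (P : pred nat) (c k n : nat) :
  perm_eq (profile_rows c [seq P x | x <- iota k n])
    [seq c + count P (iota k (x - k)) | x <- iota k n & ~~ P x].
Proof.
elim: n c k => [|n IH] c k //=.
have shift d : d = c + P k ->
    [seq d + count P (iota k.+1 (x - k.+1)) | x <- iota k.+1 n & ~~ P x]
    = [seq c + count P (iota k (x - k)) | x <- iota k.+1 n & ~~ P x].
  move=> ->; apply/eq_in_map => x; rewrite mem_filter mem_iota => /andP[_].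
  move=> /andP[kx _]; have -> : x - k = (x - k.+1).+1 by lia.
  by rewrite /= addnA.
case Pk: (P k) => /=; first by rewrite -(shift c.+1) ?Pk ?addn1.
rewrite subnn /= addn0 perm_rcons perm_cons -(shift c) ?Pk ?addn0//.
Qed.

Lemma enumerationE (T : set nat) : numerical_set T ->
  perm_eq (enumeration T)
    [seq count (fun u => `[< T u >]) (iota 0 x) | x <- fset_set (gaps T)].
Proof.
move=> nT; have [_ fT] := nT.
apply: perm_trans (profile_rowsE _ _ _ _) _.
under eq_map do rewrite add0n subn0.
apply/perm_map/uniq_perm; rewrite ?fset_uniq ?filter_uniq ?iota_uniq// => x.
rewrite mem_filter mem_iota /= add0n in_fset_set// in_setC.
rewrite -[asbool _]/(x \in T); apply: andb_idr => /negP; rewrite inE => nTx.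
rewrite ltnNge; apply/negP => hx; apply: nTx.
apply: (iffLR (@frobenius_lt T _ nT)) hx; move: (frobenius T) => F; lia.
Qed.

Lemma profile_rows_sorted (c : nat) (w : seq bool) :
  sorted geq (profile_rows c w) && all (leq c) (profile_rows c w).
Proof.
elim: w c => [|[] w IH] c //=.
  have /andP[-> /= h] := IH c.+1; apply: sub_all h => x; exact: ltnW.
have /andP[s h] := IH c; rewrite all_rcons leqnn h !andbT.
by rewrite -rev_sorted rev_rcons /= path_min_sorted ?rev_sorted ?all_rev.
Qed.

Lemma enumeration_partition (T : set nat) :
  numerical_set T -> is_partition (enumeration T).
Proof.
move=> [T0 _]; rewrite /enumeration /profile.
case: absz => [|n] //=; rewrite (asboolT T0).
exact: profile_rows_sorted.
Qed.

(* Main.v *)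
Require Import Defs.
From mathcomp Require Import all_boot all_order all_algebra.
From mathcomp Require Import finmap zify.
From mathcomp Require Import boolp classical_sets cardinality.

Set Implicit Arguments.
Unset Strict Implicit.
Unset Printing Implicit Defensive.

Local Open Scope classical_set_scope.
Local Open Scope nat_scope.

(** A partition [l] with [hooks l = gaps S] is, through its profile, the
    enumeration of a numerical set [T] whose gaps are the hook lengths of the
    first column of [l].  The hooks of [l] are then the differences [x - u] with
    [u] in [T], [x] a gap of [T] and [u < x].  Hence [hooks l = gaps S] says
    two things: [S + T] is contained in [T], and every gap [b] of [S] admits a
    [t] in [T] with [b + t] a gap of [T].  It follows that [S] is contained in
    [T] and that the Frobenius number [F] of [S] is not in [T].

    The size of the enumeration of [T] counts the pairs [(u, x)] with [u] in
    [T], [x] a gap of [T] and [u < x], one for each box of the diagram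
    ([sumn_enumeration]).  So it is enough to inject the boxes of [S] into those
    of [T] ([size_boxes_le]).  Let [m] be the multiplicity of [S]; depth 2 means
    that [m <= F < 2 m].  A box [(u, x)] of [S] with [x] outside [T] is also a
    box of [T] and stays where it is.  The boxes lost are the [(u, b)] with [b]
    in [T] but not in [S]; they have to be sent to boxes [(v, x)] of [T] with
    [v] in [T] but not in [S].
    - If [u = 0], send [(0, b)] to [(b, F)].
    - If [u > 0], then [b > m], and some [t_b] in [T] has [b + t_b] outside [T];
      it is not in [S] because [S + T] is contained in [T], and [t_b < m]
      because [b + t_b <= F < 2 m].  As [F] is not in [T], neither is [F - u],
      and one can send [(u, b)] to [(t_b, F - u)].  Alternatively, if there are
      at most two choices of [u > 0] for this [b] and [b + t_b < F], send these
      two boxes to [(b, b + t_b)] and [(t_b, b + t_b)].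
    The first rule for [u > 0] is applied exactly when the second one is not
    available, that is, when [b + t_b = F] or at least four elements of [S] lie
    below [b].  The second coordinate is [F], below [m], or strictly between [m]
    and [F], which tells the rules apart; the only possible collision is between
    [b < c] that both follow the first rule with [t_b = t_c].  Then
    [b + t_b < c + t_c <= F], so four elements of [S] lie below [b], and
    [b], [c], [b + t_b], [F] are four gaps of [S] giving parts of size at least
    4 in the enumeration of [S].  This contradicts the bound on the Durfee
    square. *)

(** * Partitions as enumerations of numerical sets *)

(** The hook length of the first box of row [i], also known as a beta-number. *)
Definition beta (l : seq nat) (i : nat) : nat := nth 0 l i + (size l - i.+1).

Definition betas (l : seq nat) : seq nat := [seq beta l i | i <- iota 0 (size l)].

Lemma parts_nonincreasing (l : seq nat) (i j : nat) :
  is_partition l -> i <= j -> nth 0 l j <= nth 0 l i.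
Proof.
move=> /andP[sl _]; case: (ltnP j (size l)) => [jl ij|jl _].
  apply: (sorted_leq_nth (leT := geq)) => //; rewrite ?inE ?(leq_ltn_trans ij) //.
    by move=> ? ? ? /= /[swap]; exact: leq_trans.
  by move=> ? /=.
by rewrite (nth_default _ jl).
Qed.

Lemma parts_gt0 (l : seq nat) (i : nat) :
  is_partition l -> i < size l -> 0 < nth 0 l i.
Proof. by move=> /andP[_ /allP al] il; apply/al/mem_nth. Qed.

Lemma beta_decreasing (l : seq nat) (i j : nat) :
  is_partition l -> j < size l -> (beta l j < beta l i) = (i < j).
Proof.
move=> hl jl; have [ij|ji] := ltnP i j; rewrite /beta.
  by have := parts_nonincreasing hl (ltnW ij); lia.
by have := parts_nonincreasing hl ji; lia.
Qed.

Lemma mem_betasP (l : seq nat) (x : nat) :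
  reflect (exists2 i, i < size l & x = beta l i) (x \in betas l).
Proof.
by apply: (iffP mapP) => -[i il ->]; exists i => //; move: il; rewrite mem_iota.
Qed.

Lemma betas_uniq (l : seq nat) : is_partition l -> uniq (betas l).
Proof.
move=> hl; rewrite map_inj_in_uniq ?iota_uniq // => i j.
rewrite !mem_iota /= => il jl e.
have := beta_decreasing i hl jl; have := beta_decreasing j hl il.
by rewrite e ltnn; lia.
Qed.

(** The smaller beta-numbers are those of the [size l - i.+1] rows below
    row [i], so this many of the [beta l i] integers below [beta l i] are gaps. *)
Lemma count_nonbetas (l : seq nat) (i : nat) : is_partition l -> i < size l ->
  count (fun u => u \notin betas l) (iota 0 (beta l i)) = nth 0 l i.
Proof.
move=> hl il; have := count_predC (fun u => u \in betas l) (iota 0 (beta l i)).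
rewrite size_iota -size_filter.
have /perm_size -> : perm_eq [seq x <- iota 0 (beta l i) | x \in betas l]
    [seq beta l k | k <- iota i.+1 (size l - i.+1)].
  apply: uniq_perm; first by rewrite filter_uniq ?iota_uniq.
    apply: (subseq_uniq _ (betas_uniq hl)); apply: map_subseq.
    have {2}-> : size l = i.+1 + (size l - i.+1) by lia.
    by rewrite iotaD suffix_subseq.
  move=> x; rewrite mem_filter mem_iota /= add0n.
  apply/andP/mapP => [[/mem_betasP[k kl ->]]|[k]].
    by rewrite beta_decreasing // => ik; exists k => //; rewrite mem_iota; lia.
  rewrite mem_iota => ik ->; have kl : k < size l by lia.
  split; first by apply/mem_betasP; exists k.
  by rewrite beta_decreasing //; case/andP: ik.
rewrite size_map size_iota; set c := count (predC _) _; rewrite /beta => e.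
by rewrite -[LHS]/c; lia.
Qed.

Lemma count_initial (n i d : nat) (P : pred nat) : d <= n ->
  (forall k, k < n -> P k = (k < d)) -> count P (iota i (n - i)) = d - i.
Proof.
move=> dn hP; rewrite (@eq_in_count _ _ (fun k => k < d)); last first.
  by move=> k; rewrite mem_iota => kn; apply: hP; lia.
have [di|id] := leqP d i.
  rewrite (@eq_in_count _ _ pred0) ?count_pred0; first lia.
  by move=> k; rewrite mem_iota /=; lia.
have -> : n - i = (d - i) + (n - d) by lia.
rewrite iotaD count_cat (@eq_in_count _ _ predT) ?count_predT ?size_iota; last first.
  by move=> k; rewrite mem_iota /=; lia.
rewrite (@eq_in_count _ _ pred0) ?count_pred0; first lia.
by move=> k; rewrite mem_iota /=; lia.
Qed.

Lemma leg_threshold (l : seq nat) (i j d : nat) : d <= size l ->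
  (forall k, k < size l -> (j < nth 0 l k) = (k < d)) -> leg l i j = d - i.+1.
Proof.
move=> dl hd; rewrite /leg -{1}(mkseq_nth 0 l) /mkseq -map_drop drop_iota.
by rewrite count_map add0n; apply: count_initial.
Qed.

(** Gives the length of a column, or the place of an integer among the
    beta-numbers, as an initial segment of the rows. *)
Lemma threshold (P : pred nat) (n : nat) : (forall i j, i <= j -> P j -> P i) ->
  exists2 d, d <= n & forall k, k < n -> P k = (k < d).
Proof.
move=> hP; elim: n => [|n [d dn hd]]; first by exists 0.
have [Pn|nPn] := boolP (P n).
  by exists n.+1 => // k kn; rewrite kn; apply: hP Pn; lia.
exists d => [|k]; first lia.
rewrite ltnS leq_eqVlt => /predU1P[->|]; last exact: hd.
by rewrite (negbTE nPn); lia.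
Qed.

(** In column [j], let [d] be the number of rows longer than [j].  The hook
    length of the box [(i, j)] is [beta l i - u] for [u = j + (size l - d)], and
    this [u] lies strictly between the beta-numbers of rows [d] and [d.-1], when
    these rows exist: it is the index in the profile of the step right that ends
    column [j].
    Conversely, given [u], the number [d] of beta-numbers above [u] determines
    [j]. *)
Lemma hooks_betas (l : seq nat) : is_partition l -> hooks l =
  [set h | exists u x, [/\ u \notin betas l, x \in betas l, u < x & h = x - u]].
Proof.
move=> hl; apply/seteqP; split=> h /=.
  move=> [i [j []]]; rewrite /in_diagram /hook_length /arm => ij ->.
  have il : i < size l.
    by rewrite ltnNge; apply/negP => li; move: ij; rewrite nth_default.
  have [d dl hd] := @threshold (fun k => j < nth 0 l k) (size l)
    (fun a b ab h => leq_trans h (parts_nonincreasing hl ab)).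
  have := hd i il; rewrite ij (leg_threshold _ dl hd) => id.
  exists (j + (size l - d)), (beta l i).
  rewrite /beta; split; [|by apply/mem_betasP; exists i|lia|lia].
  by apply/mem_betasP => -[k kl]; have := hd k kl; rewrite /beta; lia.
move=> [u [_ [nu /mem_betasP[i il ->] ux ->]]].
have mono a b : a <= b -> u < beta l b -> u < beta l a.
  by have := @parts_nonincreasing l a b hl; rewrite /beta; lia.
have [d dl hd] := @threshold (fun k => u < beta l k) (size l) mono.
have nk k : k < size l -> u != beta l k.
  by move=> kl; apply: contra nu => /eqP ->; apply/mem_betasP; exists k.
have hj k : k < size l -> (u - (size l - d) < nth 0 l k) = (k < d).
  move=> kl; have := hd k kl; have := nk k kl.
  have [kd|dk] := ltnP k d; last first.
    have d1 := leq_ltn_trans dk kl; have := hd d d1; have := nk d d1.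
    by have := @parts_nonincreasing l d k hl dk; rewrite /beta; lia.
  have d1 : d.-1 < size l by lia.
  have := parts_gt0 hl d1; have := hd d.-1 d1; have := nk d.-1 d1.
  by have := @parts_nonincreasing l k d.-1 hl ltac:(lia); rewrite /beta; lia.
exists i, (u - (size l - d)).
rewrite /in_diagram /hook_length /arm (leg_threshold _ dl hj) hj //.
have := hd i il; rewrite ux => id; split=> //.
have := hj i il; move: ux; rewrite /beta.
case: (ltnP d (size l)) => [dl'|]; last lia.
by have := parts_gt0 hl dl'; have := nk d dl'; have := hd d dl'; rewrite /beta; lia.
Qed.

Lemma partition_numerical_set (l : seq nat) : is_partition l ->
  exists T, [/\ numerical_set T, perm_eq (enumeration T) l &
    hooks l = [set h | exists u x, [/\ T u, ~ T x, u < x & h = x - u]]].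
Proof.
move=> hl; exists [set x | x \notin betas l].
have fT : finite_set (gaps [set x | x \notin betas l]).
  apply: (@sub_finite_set _ _ [set` betas l]); last exact: finite_seq.
  by move=> x /= /negP; rewrite negbK.
have nT : numerical_set [set x | x \notin betas l].
  split=> //=; apply/mem_betasP => -[i il].
  by have := parts_gt0 hl il; rewrite /beta; lia.
split=> //.
  apply: perm_trans (enumerationE nT) _.
  have /(perm_map (fun x => count (fun u => `[< u \notin betas l >]) (iota 0 x)))
      : perm_eq (fset_set (gaps [set x | x \notin betas l])) (betas l).
    apply: uniq_perm; rewrite ?fset_uniq ?betas_uniq // => x.
    rewrite in_fset_set //; apply/idP/idP; rewrite inE /gaps /=.
      by move/negP; rewrite negbK.
    by move=> xl; rewrite xl.
  move/perm_trans; apply; apply/permP => p; congr count.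
  apply: (@eq_from_nth _ 0); rewrite !size_map ?size_iota // => i il.
  rewrite (nth_map 0) ?size_map ?size_iota // (nth_map 0) ?size_iota // nth_iota //.
  by rewrite add0n -(count_nonbetas hl il); apply: eq_count => u; rewrite asboolb.
rewrite hooks_betas //; apply/seteqP.
split=> h /= [u [x [nu xl ux ->]]]; exists u, x; split=> //.
  by apply/negP; rewrite negbK.
by move/negP: xl; rewrite negbK.
Qed.

(** * Boxes and the size of an enumeration *)

(** Each box of the diagram of [enumeration T] is recorded by the index [u] of
    the step right ending its column and the index [x] of the step up ending
    its row. *)
Definition boxes (T : set nat) : seq (nat * nat) :=
  [seq (u, x) | x <- fset_set (gaps T), u <- [seq u <- iota 0 x | `[< T u >]]].

Lemma mem_boxes (T : set nat) (u x : nat) : numerical_set T ->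
  (u, x) \in boxes T <-> [/\ T u, ~ T x & u < x].
Proof.
move=> [_ fT]; split.
  move=> /allpairsPdep[y [v [+ + [-> ->]]]].
  rewrite mem_filter mem_iota in_fset_set // inE /= add0n => ny /andP[/asboolP Tv vy].
  by split.
move=> [Tu nTx ux]; apply/allpairsPdep; exists x, u; split => //.
  by rewrite in_fset_set // inE.
by rewrite mem_filter mem_iota ux; apply/andP; split=> //; apply/asboolP.
Qed.

Lemma boxes_uniq (T : set nat) : uniq (boxes T).
Proof.
apply: allpairs_uniq_dep => [|x _|]; first exact: fset_uniq.
  by rewrite filter_uniq ?iota_uniq.
by move=> [x u] [y v] _ _ /= [-> ->].
Qed.

Lemma sumn_enumeration (T : set nat) : numerical_set T ->
  sumn (enumeration T) = size (boxes T).
Proof.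
move=> nT; rewrite size_allpairs_dep (perm_sumn (enumerationE nT)); congr sumn.
by apply: eq_map => x; rewrite size_filter.
Qed.

Definition elements_below (S : set nat) (x : nat) : nat :=
  count (fun u => `[< S u >]) (iota 0 x).

Lemma size_le_elements_below (S : set nat) (x : nat) (s : seq nat) : uniq s ->
  (forall u, u \in s -> S u /\ u < x) -> size s <= elements_below S x.
Proof.
move=> us hs; rewrite /elements_below -size_filter; apply: uniq_leq_size => // u.
by move=> /hs[Su ux]; rewrite mem_filter mem_iota ux; apply/andP; split=> //; apply/asboolP.
Qed.

Lemma elements_below_homo (S : set nat) : {homo elements_below S : x y / x <= y}.
Proof.
by move=> x y xy; rewrite /elements_below -(subnKC xy) iotaD count_cat leq_addr.
Qed.

(** The part of the enumeration of [S] given by the gap [x] is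
    [elements_below S x], so the gaps in [s] give parts of size at least 4; four
    of them would make a Durfee square of size 4. *)
Lemma durfee_gaps (S : set nat) (k : nat) : numerical_set S ->
  durfee_square (enumeration S) k -> k <= 3 ->
  forall s, uniq s -> (forall x, x \in s -> ~ S x /\ 3 < elements_below S x) ->
  size s <= 3.
Proof.
move=> nS [_ _ kmax] k3 s us hs; have [_ fS] := nS.
have cnt : count (leq 4) (enumeration S) <= 3.
  by rewrite leqNgt; apply/negP => /(kmax 4 isT); lia.
apply: leq_trans cnt; have /permP -> := enumerationE nS; rewrite count_map.
rewrite -size_filter; apply: uniq_leq_size => // x /hs[nSx x4].
rewrite mem_filter in_fset_set //; apply/andP; split; first exact: x4.
by rewrite inE.
Qed.

(** * The injection between the boxes of [S] and those of [T] *)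

Section Displacement.
Variables (S T : set nat) (m F : nat).
Hypotheses (nS : numerical_set S) (nT : numerical_set T).
Hypothesis ST : forall s t, S s -> T t -> T (s + t).
Hypothesis atom : forall x, ~ S x -> exists2 t, T t & ~ T (x + t).
Hypotheses (Sm : S m) (m0 : 0 < m) (mS : forall x, S x -> 0 < x -> m <= x).
Hypotheses (nSF : ~ S F) (SF : forall x, F < x -> S x) (Fm : F < 2 * m).
Hypothesis durfee : forall s, uniq s ->
  (forall x, x \in s -> ~ S x /\ 3 < elements_below S x) -> size s <= 3.

Lemma sub_ST x : S x -> T x.
Proof. by move=> Sx; rewrite -(addn0 x); apply: ST => //; case: nT. Qed.

(** [F] being a gap of [S], some [F + t] is a gap of [T]; all integers above [F]
    are in [T], so [t = 0]. *)
Lemma nTF : ~ T F.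
Proof.
have [[|t] _ nTFt] := atom nSF; first by rewrite addn0 in nTFt.
by case: nTFt; apply/sub_ST/SF; lia.
Qed.

(** For a gap [b > m] of [S] in [T], an element [t] of [T] with [b + t] outside
    [T] is not in [S], since [S + T] is contained in [T], and depth 2 forces
    [t < m]. *)
Lemma displacement : exists t : nat -> nat, forall b, T b -> ~ S b -> m <= b ->
  [/\ T (t b), ~ S (t b), 0 < t b < m, ~ T (b + t b) & b + t b <= F].
Proof.
suff /choice[t ht] : forall b, exists c, T b -> ~ S b -> m <= b ->
    [/\ T c, ~ S c, 0 < c < m, ~ T (b + c) & b + c <= F] by exists t.
move=> b.
have [nSb|Sb] := pselect (~ S b); last by exists 0 => _ /Sb.
have [t Tt nT'] := atom nSb; exists t => Tb _ mb.
have btF : b + t <= F by rewrite leqNgt; apply/negP => /SF/sub_ST.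
have t0 : t != 0 by apply/eqP => t0; rewrite t0 addn0 in nT'.
split=> //; last lia.
by move=> St; apply: nT'; rewrite addnC; apply: ST.
Qed.

(** The injection [phi] keeps the boxes of [S] that are boxes of [T] and moves
    the box [(u, b)] with [b] in [T] to a box whose column index is in [T] but
    not in [S]. *)
Lemma size_boxes_le : size (boxes S) <= size (boxes T).
Proof.
have [t ht] := displacement.
(* [R b] selects the elements [b] whose boxes [(u, b)] with [u] nonzero are all
   moved to column [t b]. *)
pose R b := (b + t b == F) || (3 < elements_below S b).
have R_inj b c : T b -> ~ S b -> m <= b -> T c -> ~ S c -> m <= c ->
    R b -> t b = t c -> b < c -> False.
  move=> Tb nSb mb Tc nSc mc Rb e bc.
  have [_ _ _ nTbt btF] := ht b Tb nSb mb; have [_ _ ct nTct ctF] := ht c Tc nSc mc.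
  have b4 : 3 < elements_below S b by case/orP: Rb => // /eqP; lia.
  (* These are four gaps of [S] with at least four elements of [S] below. *)
  suff : 4 <= 3 by [].
  apply: (durfee (s := [:: b; c; b + t b; F])).
    rewrite /= !inE; have cbt : c <> b + t b by move=> cE; rewrite cE in Tc.
    have cF : c <> F by lia.
    by apply/and4P; split=> //; lia.
  move=> x; rewrite !inE => /or4P[] /eqP ->; split=> //;
    try (by apply: leq_trans b4 _; apply: elements_below_homo; lia).
  by move/sub_ST.
(* Outside [R] there are at most two nonzero [u] in [S] below [b], the smaller
   one being [m]; so the last rule of [phi] moves at most one box for each [b]. *)
have second_unique u v b : elements_below S b <= 3 -> S u -> S v ->
    m < u -> m < v -> u < b -> v < b -> u = v.
  move=> b3 Su Sv mu mv ub vb; apply/eqP; apply: contraLR b3 => uv; rewrite -ltnNge.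
  apply: (@size_le_elements_below S b [:: 0; m; u; v]); first by rewrite /= !inE; lia.
  by move=> x; rewrite !inE => /or4P[] /eqP ->; split=> //; [case: nS|lia..].
pose phi (p : nat * nat) := let: (u, b) := p in
  if ~~ `[< T b >] then (u, b) else
  if u == 0 then (b, F) else
  if R b then (t b, F - u) else
  if u == m then (b, b + t b) else (t b, b + t b).
have above u b : S u -> ~ S b -> u < b -> u != 0 -> m <= u /\ m < b.
  move=> Su nSb ub u0; have mu := mS Su ltac:(lia); split=> //; lia.
have nRP b : T b -> ~ S b -> m < b -> ~~ R b ->
    b + t b < F /\ elements_below S b <= 3.
  move=> Tb nSb mb; have [_ _ _ _] := ht b Tb nSb (ltnW mb).
  by rewrite /R negb_or => ? /andP[]; lia.
rewrite -(size_map phi); apply: uniq_leq_size.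
  rewrite map_inj_in_uniq ?boxes_uniq // => -[u b] [v c].
  move=> /(mem_boxes _ _ nS)[Su nSb ub] /(mem_boxes _ _ nS)[Sv nSc vc]; rewrite /phi.
  have bF : b <= F by rewrite leqNgt; apply/negP => /SF.
  have cF : c <= F by rewrite leqNgt; apply/negP => /SF.
  have [Tb|nTb] := asboolP (T b); have [Tc|nTc] := asboolP (T c) => //=.
  - have [->|u0] := eqVneq u 0; have [->|v0] := eqVneq v 0; first by case=> ->.
    + have [mv mc] := above v c Sv nSc vc v0.
      have [_ _ _ _ ?] := ht c Tc nSc (ltnW mc).
      have [Rc|/(nRP c Tc nSc mc)[? _]] := boolP (R c); first by case; lia.
      by case: eqP => _ []; lia.
    + have [mu mb] := above u b Su nSb ub u0.
      have [_ _ _ _ ?] := ht b Tb nSb (ltnW mb).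
      have [Rb|/(nRP b Tb nSb mb)[? _]] := boolP (R b); first by case; lia.
      by case: eqP => _ []; lia.
    have [mu mb] := above u b Su nSb ub u0; have [mv mc] := above v c Sv nSc vc v0.
    have [_ _ tb _ _] := ht b Tb nSb (ltnW mb).
    have [_ _ tc _ _] := ht c Tc nSc (ltnW mc).
    have [Rb|/(nRP b Tb nSb mb)[? b3]] := boolP (R b);
      have [Rc|/(nRP c Tc nSc mc)[? c3]] := boolP (R c).
    + move=> [tbc uv]; have -> : u = v by lia.
      suff -> : b = c by [].
      case: (ltngtP b c) => // [bc|cb].
        by case: (R_inj b c Tb nSb (ltnW mb) Tc nSc (ltnW mc) Rb tbc bc).
      by case: (R_inj c b Tc nSc (ltnW mc) Tb nSb (ltnW mb) Rc (esym tbc) cb).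
    + by case: (eqVneq v) => _ []; lia.
    + by case: (eqVneq u) => _ []; lia.
    case: (eqVneq u) => um; case: (eqVneq v) => vm [e1 e2]; [|lia..|].
      by rewrite um vm e1.
    have bc : b = c by lia.
    rewrite -bc in Sv nSc vc *.
    by rewrite (second_unique u v b) //; lia.
  - have [u0|u0] := eqVneq u 0; first by case=> bv _; rewrite bv in nSb.
    have [mu mb] := above u b Su nSb ub u0.
    have [_ nStb _ _ _] := ht b Tb nSb (ltnW mb).
    by case: (R b); [|case: eqP => _]; case=> e; rewrite ?e in nSb nStb.
  have [v0|v0] := eqVneq v 0; first by case=> bv _; rewrite -bv in nSc.
  have [mv mc] := above v c Sv nSc vc v0.
  have [_ nStc _ _ _] := ht c Tc nSc (ltnW mc).
  by case: (R c); [|case: eqP => _]; case=> e; rewrite -?e in nSc nStc.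
have box v x : T v -> ~ T x -> v < x -> (v, x) \in boxes T.
  by move=> *; apply/(mem_boxes _ _ nT).
move=> _ /mapP[[u b] /(mem_boxes _ _ nS)[Su nSb ub] ->]; rewrite /phi.
have [Tb|nTb] /= := asboolP (T b); last by apply: box => //; exact: sub_ST.
have bF : b < F.
  rewrite ltnNge; apply/negP; rewrite leq_eqVlt => /predU1P[Fb|/SF//].
  by rewrite -Fb in Tb; exact: nTF Tb.
have [_|u0] := eqVneq u 0; first by apply: box => //; exact: nTF.
have [mu mb] := above u b Su nSb ub u0.
have [Tt nSt tb nTbt btF] := ht b Tb nSb (ltnW mb).
have nTFu : ~ T (F - u).
  by move=> TFu; apply: nTF; rewrite -(subnKC (_ : u <= F)); [apply: ST|lia].
case: (R b); first by apply: box => //; lia.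
by case: eqP => _; apply: box => //; lia.
Qed.

End Displacement.

(** * Minimality *)

Theorem theorem1p6 (S : set nat) (hS : numerical_semigroup S)
  (hq : depth S = 2) (k : nat) (hd : durfee_square (enumeration S) k)
  (hk : k <= 3) : lambda_minimal S.
Proof.
have [nS _] := hS; have [Sm m0 mS] := multiplicityP nS.
have [F [nSF SF Fm]] : exists F, [/\ ~ S F, forall x, F < x -> S x & F < 2 * multiplicity S].
  move/(depthP _ nS): hq; rewrite /is_depth => hq.
  have [F FE] : exists F : nat, frobenius S = F.
    by exists (absz (frobenius S)); move: hq; move: (frobenius S) => f; lia.
  exists F; split; last by rewrite FE in hq; lia.
    move=> SF; have /(frobenius_lt _ nS) SF1 : (frobenius S < F.+1%:Z)%R by rewrite FE; lia.
    have /(frobenius_lt _ nS) : forall x, F <= x -> S x.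
      by move=> x; rewrite leq_eqVlt => /predU1P[<-|/SF1].
    by rewrite FE; lia.
  by apply/(frobenius_lt _ nS); rewrite FE; lia.
move=> l [hl Hl].
have [T [nT /perm_sumn <- HT]] := partition_numerical_set hl.
rewrite HT in Hl.
rewrite !sumn_enumeration //; apply: size_boxes_le Sm m0 mS nSF SF Fm _ => //.
(* A gap [s + t] of [T] would make [s] a hook length of [l]. *)
- move=> s t Ss Tt; apply: contrapT => nTst.
  suff : gaps S s by exact.
  rewrite -Hl; exists t, (s + t); split=> //; last lia.
  rewrite -[X in X < _]add0n ltn_add2r lt0n; apply/eqP => s0.
  by rewrite s0 in nTst.
(* The gap [x] is a hook length [y - t], so [x + t = y] is a gap of [T]. *)
- move=> x nSx; have : gaps S x by [].
  rewrite -Hl => -[t [y [Tt nTy ty ->]]]; exists t => //.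
  by rewrite subnK // ltnW.
exact: durfee_gaps hd hk.
Qed.
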